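(* Let $m,n\ge 1$ be integers. For every $i=0,1,\ldots,n$, the number of $(i-1)$-dimensional faces of the simplicial complex $\Delta^m_{B_n}$ is equal to $$\binom{mn+i}{i}\binom{n}{i}.$$
   Context: Definition of $\Delta^m_{B_n}$. Let $P$ be a centrally symmetric convex polygon with $2mn+2$ vertices labeled in anticlockwise order $1,2,\ldots,mn+1,\overline{1},\overline{2},\ldots,\overline{mn+1}$ (with the convention $\overline{\overline{i}}=i$). A $B$-diagonal of $P$ is either (i) a diameter, i.e. a diagonal joining antipodal points $i$ and $\overline{i}$ for some $1\le i\le mn+1$, or (ii) a pair of noncrossing diagonals $ij,\ \overline{i}\,\overline{j}$ for two distinct $i,j\in\{1,\ldots,mn+1,\overline{1},\ldots,\overline{mn+1}\}$ that are nonconsecutive around the boundary of $P$. Two diagonals cross if they meet in their relative interiors; two $B$-diagonals are noncrossing if no diagonal of one crosses a diagonal of the other. $\Delta^m_{B_n}$ is the abstract simplicial complex whose vertices are the $B$-diagonals that dissect $P$ into a pair of $(mj+2)$-gons and a centrally symmetric $(2m(n-j)+2)$-gon for some $1\le j\le n$ (for $j=n$ the central polygon degenerates to a 2-gon and the $B$-diagonal is a diameter), and whose faces are the sets of pairwise noncrossing $B$-diagonals of this type. The dimension of a face is its cardinality minus one; the empty set is the face of dimension $-1$. *)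

(* Defs.v *)
From mathcomp Require Import all_boot all_order all_algebra.
From mathcomp Require Import boolp.

Set Implicit Arguments.
Unset Strict Implicit.
Unset Printing Implicit Defensive.

Import Order.TTheory GRing.Theory Num.Theory.
Local Open Scope ring_scope.

(* The labels 1, ..., mn+1, -1, ..., -(mn+1) (minus standing for the bar) are
   encoded, in this anticlockwise order, as 0, ..., 2mn+1. The additive group
   structure of ordinals is addition modulo 2mn+2. *)
Definition vertex (m n : nat) := 'I_(2 * m * n).+2.

Definition antipode {m n : nat} (i : vertex m n) : vertex m n :=
  i + inZp (m * n).+1.

Definition consecutive (m n : nat) (i j : vertex m n) : bool :=
  (j == i + 1) || (i == j + 1).

(* Twice the signed area of the triangle abc: positive iff a, b, c is an
   anticlockwise triple, zero iff the points are collinear. *)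
Definition orient (R : realFieldType) (a b c : 'rV[R]_2) : R :=
  (b 0 0 - a 0 0) * (c 0 1 - a 0 1) - (b 0 1 - a 0 1) * (c 0 0 - a 0 0).

Definition convex_polygon (R : realFieldType) (m n : nat)
    (P : vertex m n -> 'rV[R]_2) : Prop :=
  forall i j k : vertex m n,
    (i < j)%N -> (j < k)%N -> 0 < orient (P i) (P j) (P k).

Definition centrally_symmetric (R : realFieldType) (m n : nat)
    (P : vertex m n -> 'rV[R]_2) : Prop :=
  exists c : 'rV[R]_2, forall i, P (antipode i) - c = - (P i - c).

(* Segments between vertices are encoded by their sets of endpoints. *)
Definition rel_interior (R : realFieldType) (m n : nat)
    (P : vertex m n -> 'rV[R]_2) (d : {set vertex m n}) (x : 'rV[R]_2) : Prop :=
  exists i j : vertex m n, d = [set i; j] /\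
    exists t : R, 0 < t < 1 /\ x = (1 - t) *: P i + t *: P j.

Definition crossing (R : realFieldType) (m n : nat)
    (P : vertex m n -> 'rV[R]_2) (d e : {set vertex m n}) : Prop :=
  d <> e /\ exists x, rel_interior P d x /\ rel_interior P e x.

(* A B-diagonal is encoded as the set of its one or two diagonals. *)
Definition Bdiagonal (R : realFieldType) (m n : nat)
    (P : vertex m n -> 'rV[R]_2) (b : {set {set vertex m n}}) : Prop :=
  (exists i : vertex m n, b = [set [set i; antipode i]])
  \/
  (exists i j : vertex m n,
    [/\ i <> j, ~~ consecutive i j,
        ~ crossing P [set i; j] [set antipode i; antipode j]
      & b = [set [set i; j]; [set antipode i; antipode j]]]).

Definition Bcrossing (R : realFieldType) (m n : nat)
    (P : vertex m n -> 'rV[R]_2) (b b' : {set {set vertex m n}}) : Prop :=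
  exists d e, [/\ d \in b, e \in b' & crossing P d e].

Definition one_sided (R : realFieldType) (m n : nat)
    (P : vertex m n -> 'rV[R]_2) (d S : {set vertex m n}) : bool :=
  [forall i, forall j, (d == [set i; j]) ==>
    ([forall k in S, 0 <= orient (P i) (P j) (P k)]
     || [forall k in S, orient (P i) (P j) (P k) <= 0])].

(* The polygons into which noncrossing diagonals dissect P have their vertices
   among those of P, and each is encoded by its set of vertices. These sets are
   the maximal sets of vertices not separated by any of the diagonals. *)
Definition pieces (R : realFieldType) (m n : nat)
    (P : vertex m n -> 'rV[R]_2) (b : {set {set vertex m n}}) :
    {set {set vertex m n}} :=
  [set S | maxset (fun T : {set vertex m n} =>
                     [forall d in b, one_sided P d T]) S].

(* For j = n the central polygon C is the 2-gon formed by the two endpoints of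
   the diameter; it is not one of the pieces. *)
Definition dissects (R : realFieldType) (m n : nat)
    (P : vertex m n -> 'rV[R]_2) (b : {set {set vertex m n}}) (j : nat) : Prop :=
  exists Q Q' C : {set vertex m n},
    [/\ uniq [:: Q; Q'; C],
        #|Q| = (m * j + 2)%N /\ #|Q'| = (m * j + 2)%N,
        #|C| = (2 * m * (n - j) + 2)%N,
        antipode @: C = C
      & if (j < n)%N then pieces P b = [set Q; Q'; C]
        else b = [set C] /\ pieces P b = [set Q; Q']].

Definition is_vertex (R : realFieldType) (m n : nat)
    (P : vertex m n -> 'rV[R]_2) (b : {set {set vertex m n}}) : Prop :=
  Bdiagonal P b /\ exists j : nat, (1 <= j <= n)%N /\ dissects P b j.

Definition is_face (R : realFieldType) (m n : nat)
    (P : vertex m n -> 'rV[R]_2) (F : {set {set {set vertex m n}}}) : Prop :=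
  (forall b, b \in F -> is_vertex P b) /\
  (forall b b', b \in F -> b' \in F -> b <> b' -> ~ Bcrossing P b b').

Definition DeltaB (R : realFieldType) (m n : nat)
    (P : vertex m n -> 'rV[R]_2) : {set {set {set {set vertex m n}}}} :=
  [set F | `[< is_face P F >]].

Definition face_dim (m n : nat) (F : {set {set {set vertex m n}}}) : int :=
  #|F|%:Z - 1.

(* Main.v *)
Require Import Defs.
From mathcomp Require Import all_boot all_order all_algebra.
From mathcomp Require Import boolp.
From mathcomp Require Import zify ring lra.

Set Implicit Arguments.
Unset Strict Implicit.
Unset Printing Implicit Defensive.

Import Order.TTheory GRing.Theory Num.Theory.

(** Modulo the central symmetry, the vertices of the polygon become mn+1 points
on a circle, and a B-diagonal cutting off (mj+2)-gons becomes the arc of length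
mj+1 that starts at a point a of this circle; diameters are the loops, of
length mn+1.  A B-diagonal is thus a pair (a, j), and two of them cross exactly
when their arcs overlap without being nested ([Bcrossing_bdiag]).  So the faces
are the noncrossing sets of arcs ([is_face_bdiag]), and the rest of the proof
counts these.

In a noncrossing set of arcs, give each arc its own size, the l >= 1 for which
the region directly below it, above the arcs nested in it, is an (ml+2)-gon.
An arc of size j satisfies j = sum of the own sizes of all arcs nested in it,
itself included.  The own sizes of the arcs that start at a point a, added from
the shortest arc to the longest one, have distinct partial sums t; these are
recorded as marks (a, t).  The largest mark at a is the sum W(a) of all own
sizes at a, and the sum of all W(a) is at most n, since the vertices hidden
below arcs are m * (sum of W) of the mn+1 points and one point is never hidden.
A set of marks with this property is called balanced.

Conversely a balanced set of marks determines the arcs.  Walk away from a: below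
the arc of a mark t at a there must be m*t points for this arc and the shorter
arcs from a, and m*W(u) points for each start u that it passes over; it ends
just after the first point where as many have been met.  The number of points still
missing decreases by at most 1 at each step, so that it does reach 0, and this
is where the arc of the mark ends ([closes_ex]).  First passage makes the arcs
noncrossing ([arcs_of_noncrossing]).  The marks can be read off the arcs, the
shortest arcs first ([arcs_of_sub]), and every noncrossing set of arcs arises,
as is seen by adding its arcs from the shortest to the longest
([arcs_of_surj]).  Hence there are as many noncrossing sets of i arcs as
balanced sets of i marks.

A balanced set of i marks is a list of mn+1 subsets of {1, ..., n}, of total
size i, whose maxima add up to at most n.  Put end to end, these subsets form
an i-subset of {1, ..., n} cut into mn+1 possibly empty blocks, which gives
'C(n, i) * 'C(mn+i, i) possibilities ([card_marked]). *)

(** * Noncrossing arcs on a circle *)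

Section Arcs.
Variables m n : nat.
Hypothesis m_gt0 : 0 < m.
Notation M := (m * n).+1.
Notation arc := ('I_M * 'I_n)%type.
Implicit Types (x y : arc) (F G : {set arc}).

(** The pair (a, j) stands for the arc from a of length m * j.+1 + 1.  Only the
overlaps in which y starts after x are seen by this relation; [d] is the
distance from the start of x to that of y, which lies strictly below x when
0 < d <= m * x.2.+1. *)
Definition overlaps x y : bool :=
  let d := (y.1 + (M - x.1)) %% M in
  [&& 0 < d, d <= m * x.2.+1 & m * x.2.+1 < d + m * y.2.+1].

Definition noncrossing F : bool :=
  [forall x in F, forall y in F, ~~ overlaps x y].

(** The pair (a, t) stands for the mark t.+1 at the point a.  Positions are
natural numbers read modulo the number of points, so that walks around the
circle need no modular arithmetic. *)
Definition weight G (p : nat) : nat :=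
  \max_(t : 'I_n | (inZp p, t) \in G) t.+1.

Definition weights G (p d : nat) : nat := \sum_(k < d) weight G (p + k).

Definition balanced G : bool := \sum_(a < M) weight G a <= n.

(** With W the weight, after d steps from p an arc of mark t.+1 has still
m * (t.+1 + sum of W over p+1, ..., p+d) - d points to hide.  This number is 0
at d = m * j.+1, where the next point is the end of the arc, and it is positive
before. *)
Definition closes G (p t j : nat) : bool :=
  (t.+1 + weights G p.+1 (m * j.+1) == j.+1) &&
  [forall d : 'I_(m * j.+1), d < m * (t.+1 + weights G p.+1 d)].

Definition close_arc G x : arc :=
  (x.1, odflt x.2 [pick j : 'I_n | closes G x.1 x.2 j]).

Definition arcs_of G : {set arc} := close_arc G @: G.

(** Over natural positions, an arc that starts strictly below another one, d
steps after its start, must end no later than it. *)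
Lemma noncrossingP F :
  reflect (forall p d (j k : 'I_n), (inZp p, j) \in F ->
             (inZp (p + d), k) \in F -> 0 < d <= m * j.+1 ->
             d + m * k.+1 <= m * j.+1)
          (noncrossing F).
Proof.
apply: (iffP forall_inP) => [nc p d j k pF qF /andP[d0 dj]|nc [a j] xF].
  have jn := ltn_ord j.
  have dM : d < M by rewrite ltnS (leq_trans dj) // leq_mul2l jn orbT.
  have /forall_inP/(_ _ qF) := nc _ pF.
  rewrite /overlaps /=.
  have -> : ((p + d) %% M + (M - p %% M)) %% M = d.
    have pM : p %% M < M by rewrite ltn_mod.
    have E : p = p %/ M * M + p %% M by exact: divn_eq.
    rewrite modnDml (_ : _ + _ = (p %/ M).+1 * M + d); last by lia.
    by rewrite modnMDl modn_small.
  by rewrite d0 dj /= -leqNgt.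
apply/forall_inP => -[b k] yF; rewrite /overlaps /=.
set d := (_ %% _); apply/negP => /and3P[d0 dj].
rewrite ltnNge; case/negP.
have aM := ltn_ord a.
apply: (nc a d); rewrite ?valZpK ?d0 ?dj //.
suff -> : inZp (a + d) = b by [].
apply/val_inj; rewrite /= /d modnDmr addnCA subnKC ?modnDr ?modn_small //.
exact: ltnW.
Qed.

Lemma weight_ge G p (t : 'I_n) : (inZp p, t) \in G -> t < weight G p.
Proof. by move=> tG; apply: (leq_bigmax_cond (F := fun t : 'I_n => t.+1)). Qed.

Lemma weight_leP G p k :
  reflect (forall t : 'I_n, (inZp p, t) \in G -> t < k) (weight G p <= k).
Proof. exact: bigmax_leqP. Qed.

Lemma weight_attained G p : 0 < weight G p ->
  exists2 t : 'I_n, (inZp p, t) \in G & weight G p = t.+1.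
Proof.
move=> w0.
case: (pickP (fun t : 'I_n => (inZp p, t) \in G)) => [t0 t0G|none].
  have : 0 < #|[pred t : 'I_n | (inZp p, t) \in G]| by apply/card_gt0P; exists t0.
  by case/(eq_bigmax_cond (fun t : 'I_n => t.+1)) => t tG E; exists t.
by move: w0; rewrite /weight big_pred0.
Qed.

Lemma weight_mod G p q : p = q %[mod M] -> weight G p = weight G q.
Proof.
by move=> pq; rewrite /weight; suff -> : inZp p = inZp q :> 'I_M by []; apply/val_inj.
Qed.

Lemma weights0 G p : weights G p 0 = 0.
Proof. by rewrite /weights big_ord0. Qed.

Lemma weights_cat G p d e :
  weights G p (d + e) = weights G p d + weights G (p + d) e.
Proof.
rewrite /weights big_split_ord /=; congr (_ + _).
by apply: eq_bigr => k _; rewrite addnA.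
Qed.

Lemma weights_cons G p d : weights G p d.+1 = weight G p + weights G p.+1 d.
Proof. by rewrite -add1n weights_cat /weights big_ord1 addn0 addn1. Qed.

Lemma weights_rcons G p d :
  weights G p d.+1 = weights G p d + weight G (p + d).
Proof. by rewrite /weights big_ord_recr. Qed.

Lemma weights_turn G p : weights G p M = \sum_(a < M) weight G a.
Proof.
elim: p => [|p IH]; first by [].
rewrite -IH weights_rcons weights_cons addnC; congr (_ + _).
by apply: weight_mod; rewrite addSnnS modnDr.
Qed.

Lemma closesP G p t j :
  reflect (t.+1 + weights G p.+1 (m * j.+1) = j.+1 /\
           forall d, d < m * j.+1 -> d < m * (t.+1 + weights G p.+1 d))
          (closes G p t j).
Proof.
apply: (iffP andP) => [[/eqP-> /forallP H]|[-> H]]; split=> //.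
  by move=> d dj; apply: (H (Ordinal dj)).
by apply/forallP => d; apply: H.
Qed.

Lemma closes_inj_size G p t j j' : closes G p t j -> closes G p t j' -> j = j'.
Proof.
suff le k k' : closes G p t k -> closes G p t k' -> k' <= k.
  by move=> cj cj'; apply/eqP; rewrite eqn_leq !(le _ _ cj cj', le _ _ cj' cj).
case/closesP=> E _ /closesP[_ H]; rewrite leqNgt; apply/negP => kk'.
have := H (m * k.+1); rewrite E ltn_pmul2l // ltnS => /(_ kk').
by rewrite ltnn.
Qed.

Lemma closes_inj_mark G p t t' j : closes G p t j -> closes G p t' j -> t = t'.
Proof. by case/closesP=> E _ /closesP[E' _]; lia. Qed.

Lemma closes_mod G p q t j :
  p = q %[mod M] -> closes G p t j = closes G q t j.
Proof.
move=> pq; have W d : weights G p.+1 d = weights G q.+1 d.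
  apply: eq_bigr => k _; apply: weight_mod.
  by rewrite !addSnnS -modnDml pq modnDml.
by rewrite /closes W; congr (_ && _); apply: eq_forallb => d; rewrite W.
Qed.

(** The number of points to hide starts positive, decreases by at most 1 per
step, and is nonpositive after m * n steps because the walk has then passed all
the other points.  Its first zero is a multiple of m by the very equation that
it satisfies. *)
Lemma closes_ex G (p : nat) (t : 'I_n) : balanced G -> (inZp p, t) \in G ->
  exists j : 'I_n, closes G p t j.
Proof.
move=> bG tG.
pose Q d := m * (t.+1 + weights G p.+1 d) <= d.
have ex : exists d, Q d.
  exists (m * n); rewrite /Q leq_mul2l; apply/orP; right.
  move: bG; rewrite /balanced -(weights_turn G p) weights_cons.
  by have := weight_ge tG; lia.
have Qmn : Q (m * n).
  rewrite /Q leq_mul2l; apply/orP; right.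
  move: bG; rewrite /balanced -(weights_turn G p) weights_cons.
  by have := weight_ge tG; lia.
case: (ex_minnP ex) => -[|d] Qd dmin.
  by move: Qd; rewrite /Q; rewrite leqn0 muln_eq0; lia.
have nQ e : e <= d -> e < m * (t.+1 + weights G p.+1 e).
  move=> ed; rewrite ltnNge; apply/negP => /dmin; lia.
have Ed : m * (t.+1 + weights G p.+1 d.+1) = d.+1.
  apply/eqP; rewrite eqn_leq; apply/andP; split; first exact: Qd.
  apply: leq_trans (nQ d (leqnn d)) _.
  by rewrite leq_mul2l weights_rcons; apply/orP; right; lia.
set s := t.+1 + _ in Ed.
have Es : t.+1 + weights G p.+1 d.+1 = s by [].
have s0 : 0 < s by rewrite /s.
clearbody s.
have sn : s.-1 < n.
  have := dmin _ Qmn; rewrite -Ed leq_mul2l; case: n s0 => [|n']; lia.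
exists (Ordinal sn); apply/closesP => /=.
rewrite prednK // Ed Es; split=> // e ed; exact: nQ.
Qed.

Lemma close_arcE G x (j : 'I_n) : closes G x.1 x.2 j -> close_arc G x = (x.1, j).
Proof.
move=> cj; rewrite /close_arc; case: pickP => [k ck|/(_ j)]; last by rewrite cj.
by congr (_, _); apply/val_inj/(closes_inj_size ck cj).
Qed.

Lemma mem_arcs_of G p (j : 'I_n) : balanced G ->
  reflect (exists2 t : 'I_n, (inZp p, t) \in G & closes G p t j)
          ((inZp p, j) \in arcs_of G).
Proof.
move=> bG.
have E t k : closes G (inZp p : 'I_M) t k = closes G p t k.
  by apply: closes_mod; rewrite /= modn_mod.
apply: (iffP imsetP) => [[[a t] tG]|[t tG cj]].
  have [k ck] : exists k : 'I_n, closes G a t k.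
    by apply: closes_ex; rewrite ?valZpK.
  rewrite (@close_arcE _ (a, t) k) //= => -[pa ->]; exists t; rewrite ?pa //.
  by rewrite -E pa.
by exists (inZp p, t); rewrite // (@close_arcE _ (_, _) j) //= E.
Qed.

Lemma card_arcs_of G : balanced G -> #|arcs_of G| = #|G|.
Proof.
move=> bG; apply: card_in_imset => -[a t] [b s] tG sG.
have [k ck] : exists k : 'I_n, closes G a t k by apply: closes_ex; rewrite ?valZpK.
have [l cl] : exists l : 'I_n, closes G b s l by apply: closes_ex; rewrite ?valZpK.
rewrite (@close_arcE _ (a, t) k) // (@close_arcE _ (b, s) l) //= => -[ab kl].
rewrite ab kl in ck *; congr (_, _); apply/val_inj; exact: closes_inj_mark ck cl.
Qed.

(** If an arc passes over the start of another one, then at that start it has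
still more points to hide than the second arc, whose mark is counted in the
weight there.  So the first arc cannot end strictly before the second. *)
Lemma arcs_of_noncrossing G : balanced G -> noncrossing (arcs_of G).
Proof.
move=> bG; apply/noncrossingP => p d j k /(mem_arcs_of _ _ bG)[t tG ct].
move=> /(mem_arcs_of _ _ bG)[s sG cs] /andP[d0 dj].
rewrite leqNgt; apply/negP => lt.
case/closesP: ct => Et lowt; case/closesP: cs => Es lows.
case: d d0 dj lt sG Es lows => // d _ dj lt sG Es lows.
have := lows (m * j.+1 - d.+1); rewrite ltn_subLR // => /(_ lt).
have W : weights G p.+1 (m * j.+1) = weights G p.+1 d + weight G (p + d.+1) +
    weights G (p + d.+1).+1 (m * j.+1 - d.+1).
  by rewrite -{1}(subnKC dj) weights_cat weights_rcons !addSnnS !addnS.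
have := lowt d dj; have : m * s.+1 <= m * weight G (p + d.+1).
  by rewrite leq_mul2l (weight_ge sG) orbT.
have := congr1 (muln m) Et; rewrite W !mulnDr.
lia.
Qed.

(** Arcs that start and end among d + 1 consecutive points hide at most d - 1
points, since the two end points stay visible.  The proof jumps from the start
of the longest arc at p to its end. *)
Lemma weights_arcs_le G p d : balanced G ->
  (forall k (j : 'I_n), k < d -> (inZp (p + k), j) \in arcs_of G ->
     k + (m * j.+1).+1 <= d) ->
  m * weights G p d <= d.-1.
Proof.
move=> bG; elim: d {-2}d (leqnn d) p => [|D IH] d dD p H.
  by move: dD; rewrite leqn0 => /eqP->; rewrite weights0 muln0.
case: d dD H => [|d] dD H; first by rewrite weights0 muln0.
case: (posnP (weight G p)) => [w0|/weight_attained[t tG Et]].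
  rewrite weights_cons w0 add0n; apply: leq_trans (leq_pred _); apply: IH; first lia.
  by move=> k j kd kF; have := H k.+1 j; rewrite -addSnnS => /(_ kd kF); lia.
have [j cj] := closes_ex bG tG.
have jd : m * j.+1 <= d.
  have := H 0 j; rewrite addn0; move/(_ isT).
  by apply; apply/mem_arcs_of => //; exists t.
rewrite weights_cons Et -(subnKC jd) weights_cat.
rewrite addnA; case/closesP: (cj) => -> _; rewrite mulnDr.
set e := d - _.
suff : m * weights G (p.+1 + m * j.+1) e <= e.-1 by rewrite /e; lia.
apply: IH; first by rewrite /e; lia.
move=> k l ke kF; have := H (k + (m * j.+1).+1) l.
have -> : p + (k + (m * j.+1).+1) = p.+1 + m * j.+1 + k by lia.
by move/(_ _ kF); rewrite /e in ke *; lia.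
Qed.

(** The mark of an arc is its size minus the weights that it passes over, and
by noncrossing these come from strictly shorter arcs.  So marks are determined
by induction on the size. *)
Lemma arcs_of_sub G1 G2 : balanced G1 -> balanced G2 ->
  arcs_of G1 = arcs_of G2 -> G1 \subset G2.
Proof.
move=> b1 b2 E12.
have key : forall j p (t1 t2 : 'I_n), j < n ->
    (inZp p, t1) \in G1 -> closes G1 p t1 j ->
    (inZp p, t2) \in G2 -> closes G2 p t2 j -> t1 = t2.
  elim/ltn_ind => j IH p t1 t2 jn t1G c1 t2G c2.
  suff W : weights G1 p.+1 (m * j.+1) = weights G2 p.+1 (m * j.+1).
    by case/closesP: c1 => e1 _; case/closesP: c2 => e2 _; apply/val_inj => /=; lia.
  have pF : (inZp p, Ordinal jn) \in arcs_of G1.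
    by apply/mem_arcs_of => //; exists t1.
  have small (i : 'I_(m * j.+1)) (k : 'I_n) :
      (inZp (p.+1 + i), k) \in arcs_of G1 -> k < j.
    rewrite addSnnS => kF.
    have /noncrossingP := arcs_of_noncrossing b1.
    move=> /(_ _ _ _ _ pF kF); rewrite /= ltn_ord => /(_ isT) le.
    rewrite -ltnS -(ltn_pmul2l m_gt0); lia.
  apply: eq_bigr => i _; apply/eqP; rewrite eqn_leq; apply/andP; split.
    apply/weight_leP => s sG; have [k ck] := closes_ex b1 sG.
    have kF : (inZp (p.+1 + i), k) \in arcs_of G1.
      by apply/mem_arcs_of => //; exists s.
    have /(mem_arcs_of _ _ b2)[s' s'G ck'] : (inZp (p.+1 + i), k) \in arcs_of G2.
      by rewrite -E12.
    rewrite (IH k (small _ _ kF) _ _ _ (ltn_ord k) sG ck s'G ck').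
    exact: weight_ge.
  apply/weight_leP => s sG; have [k ck] := closes_ex b2 sG.
  have kF : (inZp (p.+1 + i), k) \in arcs_of G1.
    by rewrite E12; apply/mem_arcs_of => //; exists s.
  have /(mem_arcs_of _ _ b1)[s' s'G ck'] := kF.
  rewrite -(IH k (small _ _ kF) _ _ _ (ltn_ord k) s'G ck' sG ck).
  exact: weight_ge.
apply/subsetP => -[a t] tG; have tG' : (inZp a, t) \in G1 by rewrite valZpK.
have [j cj] := closes_ex b1 tG'.
have /(mem_arcs_of _ _ b2)[s sG cs] : (inZp a, j) \in arcs_of G2.
  by rewrite -E12; apply/mem_arcs_of => //; exists t.
by rewrite (key j a t s) //; move: sG; rewrite valZpK.
Qed.

Lemma arcs_of_inj : {in balanced &, injective arcs_of}.
Proof.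
move=> G1 G2 b1 b2 E; apply/eqP; rewrite eqEsubset.
by rewrite !arcs_of_sub.
Qed.

(** Induction on the number of arcs: a longest arc lies below no other, hence
giving it a mark does not disturb the other arcs.  This mark is forced to be its
size minus the weight strictly below it. *)
Lemma arcs_of_surj F : noncrossing F -> exists2 G, balanced G & arcs_of G = F.
Proof.
move: {2}#|F| (erefl #|F|) => c; elim: c F => [|c IH] F Fc ncF.
  exists set0; last by rewrite /arcs_of imset0 (cards0_eq Fc).
  rewrite /balanced big1 // => a _; rewrite /weight big_pred0 // => t.
  by rewrite inE.
have [x0 x0F] : exists x0, x0 \in F by apply/card_gt0P; rewrite Fc.
case: (arg_maxnP (fun x : arc => x.2 : nat) x0F) => -[a j] xF' jmax.
have xF : (a, j) \in F := xF'.
pose F' := F :\ (a, j).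
have F'F y : y \in F' -> y \in F by rewrite in_setD1 => /andP[].
have ncF' : noncrossing F'.
  apply/forall_inP => y yF; apply/forall_inP => z zF.
  by have /forall_inP/(_ y (F'F y yF))/forall_inP/(_ z (F'F z zF)) := ncF.
have [|G' bG' EF'] := IH F' _ ncF'.
  by move: (cardsD1 (a, j) F); rewrite xF Fc => -[].
have jn := ltn_ord j.
have mjn : m * j.+1 <= m * n by rewrite leq_mul2l jn orbT.
(* No other arc passes over a: it would be longer than the longest arc. *)
have off u (k : 'I_n) i : (inZp u, k) \in F' -> i < m * k.+1 ->
    inZp (u.+1 + i) != a.
  move=> uF ik; apply/eqP => ua.
  move/noncrossingP: ncF => /(_ u i.+1 k j (F'F _ uF)).
  rewrite -addSnnS ua => /(_ xF); rewrite ltnS ik => /(_ isT).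
  have := jmax _ (F'F _ uF) => /= kj.
  have : m * k.+1 <= m * j.+1 by rewrite leq_mul2l; lia.
  lia.
have inner k (l : 'I_n) : k < m * j.+1 -> (inZp (a.+1 + k), l) \in F' ->
    k + (m * l.+1).+1 <= m * j.+1.
  move=> kj lF; move/noncrossingP: ncF => /(_ a k.+1 j l).
  by rewrite valZpK -addSnnS xF F'F // ltnS kj => /(_ isT isT isT); lia.
(* After d steps the inner arcs cannot hide all points that remain below (a, j). *)
have low d : d < m * j.+1 ->
    d + m * (weights G' (a.+1 + d) (m * j.+1 - d)) < m * j.+1.
  move=> dj; have := @weights_arcs_le G' (a.+1 + d) (m * j.+1 - d) bG'.
  rewrite EF' => H.
  suff : m * weights G' (a.+1 + d) (m * j.+1 - d) <= (m * j.+1 - d).-1 by lia.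
  apply: H => k l kd; rewrite -addnA => /inner; lia.
have W0 : weights G' a.+1 (m * j.+1) < j.+1.
  rewrite -(ltn_pmul2l m_gt0).
  by have := low 0; rewrite addn0 subn0 add0n; apply; rewrite muln_gt0 m_gt0.
pose t0 := j - weights G' a.+1 (m * j.+1).
have t0n : t0 < n by rewrite /t0; lia.
pose t := Ordinal t0n.
have cx' : closes G' a t j.
  apply/closesP; split=> [|d dj]; first by rewrite /= /t0; lia.
  have := low d dj.
  have Et : t.+1 + weights G' a.+1 (m * j.+1) = j.+1 by rewrite /= /t0; lia.
  rewrite -[in X in _ -> X](ltn_add2r (m * weights G' (a.+1 + d) (m * j.+1 - d))).
  by rewrite -mulnDr -addnA -weights_cat subnKC ?Et // ltnW.
(* The new mark must exceed the old marks at a, so as to become the weight. *)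
have tmax (s : 'I_n) : (a, s) \in G' -> s < t.
  move=> sG; have sG' : (inZp a, s) \in G' by rewrite valZpK.
  have [k ck] := closes_ex bG' sG'.
  have kF : (a, k) \in F'.
    by rewrite -[a]valZpK -EF'; apply/mem_arcs_of => //; exists s.
  have kj : k < j.
    rewrite ltn_neqAle; apply/andP; split; last exact: (jmax _ (F'F _ kF)).
    by apply: contraTneq kF => /val_inj->; rewrite in_setD1 eqxx.
  case/closesP: cx' => _ /(_ (m * k.+1)); rewrite ltn_pmul2l // ltnS => /(_ kj).
  by rewrite ltn_pmul2l //; case/closesP: ck => E _; rewrite -[ltnLHS]E ltn_add2r.
pose G := (a, t) |: G'.
have wG p : inZp p != a -> weight G p = weight G' p.
  by move=> pa; apply: eq_bigl => s; rewrite in_setU1 xpair_eqE (negPf pa).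
have wGa : weight G a = t.+1.
  apply/eqP; rewrite eqn_leq; apply/andP; split.
    apply/weight_leP => s; rewrite valZpK in_setU1 xpair_eqE eqxx /=.
    by case/orP=> [/eqP->|/tmax/ltnW]; [exact: ltnSn|rewrite ltnS].
  by apply: weight_ge; rewrite valZpK in_setU1 eqxx.
have sumG : forall d, d <= m * n -> weights G a.+1 d = weights G' a.+1 d.
  move=> d dn; apply: eq_bigr => -[i id] _; apply: wG => /=.
  have aM := ltn_ord a.
  apply/eqP => /(congr1 val) /= E.
  have /eqP : a + i.+1 = a + 0 %[mod M] by rewrite addn0 -addSnnS E modn_small.
  by rewrite eqn_modDl mod0n modn_small //; lia.
have cl u (s k : 'I_n) : (inZp u, k) \in F' -> closes G' u s k -> closes G u s k.
  move=> uF /closesP[E L].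
  have W d : d <= m * k.+1 -> weights G u.+1 d = weights G' u.+1 d.
    move=> dk; apply: eq_bigr => i _; apply: wG; apply: off uF _.
    exact: leq_trans (ltn_ord i) dk.
  by apply/closesP; rewrite W //; split=> // d dk; rewrite W ?L // ltnW.
have cx : closes G a t j.
  case/closesP: cx' => E L; apply/closesP; rewrite sumG //; split=> // d dj.
  by rewrite sumG ?L //; lia.
(* For the bound on the total weight, cut the circle at a and at the end of
   (a, j); no arc that starts outside of (a, j) passes over a. *)
exists G.
  rewrite /balanced -(weights_turn G a) weights_cons wGa sumG //.
  have -> : weights G' a.+1 (m * n) = weights G' a.+1 (m * j.+1) +
      weights G' (a.+1 + m * j.+1) (m * n - m * j.+1).
    by rewrite -weights_cat subnKC.
  rewrite addnA; case/closesP: cx' => -> _.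
  have := @weights_arcs_le G' (a.+1 + m * j.+1) (m * n - m * j.+1) bG'.
  rewrite EF' => H.
  suff : m * weights G' (a.+1 + m * j.+1) (m * n - m * j.+1) <= m * (n - j.+1).
    by rewrite leq_pmul2l //; lia.
  rewrite mulnBr; apply: leq_trans (leq_pred _); apply: H => k l kd lF.
  have H' := off _ _ (m * n - m * j.+1 - k.+1) lF.
  rewrite leqNgt; apply/negP => lt.
  have /H' : m * n - m * j.+1 - k.+1 < m * l.+1.
    by rewrite ltn_subLR // addSnnS.
  case/negP; apply/eqP/val_inj => /=.
  have -> : (a.+1 + m * j.+1 + k).+1 + (m * n - m * j.+1 - k.+1) = a + M by lia.
  by rewrite modnDr modn_small.
rewrite /arcs_of imsetU1 (@close_arcE G (a, t) j) //.
rewrite (_ : close_arc G @: G' = F') ?setD1K //.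
rewrite -EF'; apply: eq_in_imset => -[u s] sG.
have sG' : (inZp u, s) \in G' by rewrite valZpK.
have [k ck] := closes_ex bG' sG'.
have kF : (inZp u, k) \in F' by rewrite -EF'; apply/mem_arcs_of => //; exists s.
by rewrite !(@close_arcE _ (u, s) k) //=; apply: cl.
Qed.

Lemma card_noncrossing i :
  #|[set F | noncrossing F && (#|F| == i)]| =
  #|[set G | balanced G && (#|G| == i)]|.
Proof.
rewrite -[RHS](card_in_imset (f := arcs_of)); last first.
  move=> G1 G2; rewrite !inE => /andP[b1 _] /andP[b2 _]; exact: arcs_of_inj.
apply: eq_card => F; rewrite inE; apply/andP/imsetP => [[nc Fi]|[G]].
  have [G bG EG] := arcs_of_surj nc; exists G => //.
  by rewrite inE bG -card_arcs_of // EG.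
by rewrite inE => /andP[bG Gi] ->; rewrite arcs_of_noncrossing // card_arcs_of.
Qed.
End Arcs.

(** * Counting balanced sets of marks *)

Section Count.
Variable n : nat.
Set Printing Width 100.
Implicit Types T : {set 'I_n}.

(** The largest mark of a column, or 0; as the mark of t is t.+1, this is
[weight] for a single point. *)
Definition top T : nat := \max_(t in T) t.+1.

Lemma top_le T b : (top T <= b) = (T \subset [set t : 'I_n | t < b]).
Proof.
apply/bigmax_leqP/subsetP => H t tT; first by rewrite inE H.
by have := H t tT; rewrite inE.
Qed.

Lemma card_below b : b <= n -> #|[set t : 'I_n | t < b]| = b.
Proof.
move=> bn; have inj : injective (widen_ord bn) by move=> u v /(congr1 val) /= /val_inj.
rewrite -[RHS]card_ord -(card_imset _ inj).
apply: eq_card => t; rewrite inE; apply/idP/imsetP => [tb|[u _ ->]].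
  by exists (Ordinal tb) => //; apply/val_inj.
exact: (ltn_ord u).
Qed.

(** Choosing a k-subset T and then an r-subset of what lies above its top is the
same as choosing a (k + r)-subset and splitting it after its k-th element. *)
Lemma sum_top_bin b k r : b <= n ->
  \sum_(T : {set 'I_n} | (#|T| == k) && (top T <= b)) 'C(b - top T, r) = 'C(b, k + r).
Proof.
elim: r b => [|r IHr] b.
  move=> bn; rewrite addn0 -[in RHS](card_below bn) -cards_draws -sum1_card.
  rewrite big_mkcond [in RHS]big_mkcond.
  by apply: eq_bigr => T _; rewrite inE top_le andbC bin0.
elim: b => [|b IHb] bn.
  by rewrite addnS bin0n big1 // => T _; rewrite sub0n bin0n.
rewrite addnS binS -addnS -IHb ?(ltnW bn) // -IHr ?(ltnW bn) // -big_split /=.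
rewrite [LHS]big_mkcond [RHS]big_mkcond; apply: eq_bigr => T _.
case: eqP => //= _; case: (ltngtP (top T) b.+1) => [lt|gt|->].
- by move: lt; rewrite ltnS => le; rewrite le subSn // binS.
- by rewrite (_ : (top T <= b) = false) //; lia.
- by rewrite subnn bin0n ltnn.
Qed.

Lemma sum_bin_diag q i : \sum_(s < i.+1) 'C((q + s).-1, s) = 'C(q + i, i).
Proof.
elim: i => [|i IH]; first by rewrite big_ord1 addn0 !bin0.
by rewrite big_ord_recr /= IH addnS binS addnC.
Qed.

Definition marked q b i (s : q.-tuple {set 'I_n}) : bool :=
  (\sum_(k < q) top (tnth s k) <= b) && (\sum_(k < q) #|tnth s k| == i).

Lemma sum_cons_tuple q (f : {set 'I_n} -> nat) T (s : q.-tuple {set 'I_n}) :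
  \sum_(k < q.+1) f (tnth (cons_tuple T s) k) = f T + \sum_(k < q) f (tnth s k).
Proof.
rewrite big_ord_recl; congr (_ + _); apply: eq_bigr => k _.
by rewrite !(tnth_nth set0).
Qed.

(** Split off the first column T.  For fixed #|T| the tops are summed by
[sum_top_bin], which leaves the factor 'C(b, i), and the other factors add up
along a diagonal of the triangle of Pascal. *)
Lemma card_marked q b i : b <= n ->
  #|[set s : q.-tuple {set 'I_n} | marked b i s]| = 'C((q + i).-1, i) * 'C(b, i).
Proof.
elim: q b i => [|q IH] b i bn.
  have E : [set s : 0.-tuple {set 'I_n} | marked b i s] =
            if i == 0 then setT else set0.
    apply/setP => s; rewrite !inE /marked !big_ord0 /= eq_sym.
    by case: eqP => _; rewrite inE.
  rewrite E add0n; case: i {E} => [|i] /=; last by rewrite cards0 bin_small.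
  by rewrite cardsT card_tuple expn0 !bin0.
transitivity (\sum_(T : {set 'I_n}) if (#|T| <= i) && (top T <= b)
   then 'C((q + (i - #|T|)).-1, i - #|T|) * 'C(b - top T, i - #|T|) else 0).
  rewrite -sum1_card big_mkcond /=; under eq_bigr do rewrite inE.
  rewrite (reindex (fun p : {set 'I_n} * q.-tuple {set 'I_n} => cons_tuple p.1 p.2)) /=;
    last first.
    exists (fun s => (thead s, behead_tuple s)) => [[T s] _|s _] /=.
      by rewrite theadE; congr (_, _); apply/val_inj.
    by rewrite [RHS]tuple_eta; apply/val_inj.
  rewrite -(pair_bigA _ (fun T (s : q.-tuple {set 'I_n}) =>
    if marked b i (cons_tuple T s) then 1 else 0)) /=.
  apply: eq_bigr => T _; rewrite -big_mkcond sum1_card.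
  case: ifP => [/andP[Ti Tb]|Tib].
    rewrite -IH ?(leq_trans (leq_subr _ _)) //.
    apply: eq_card => s; rewrite unfold_in /= ?inE /marked.
    rewrite (sum_cons_tuple top) (sum_cons_tuple (fun A => #|A|)) /=.
    by apply/idP/idP; lia.
  apply: eq_card0 => s; rewrite unfold_in /= ?inE /marked.
  rewrite (sum_cons_tuple top) (sum_cons_tuple (fun A => #|A|)) /=.
  by apply/negP; move/negP: Tib; lia.
rewrite -big_mkcond (partition_big (fun T => inord #|T| : 'I_i.+1) xpredT) //=.
transitivity (\sum_(k < i.+1) 'C((q + (i - k)).-1, i - k) * 'C(b, i)).
  apply: eq_bigr => k _; have ki : k <= i := ltn_ord k.
  rewrite -[in 'C(b, i)](subnKC ki) -sum_top_bin // big_distrr /=.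
  apply: congr_big => // [T|T /andP[/andP[Ti _] /eqP <-]]; last first.
    by rewrite inordK.
  rewrite andbAC; congr (_ && _); case: (leqP #|T| i) => /= [Ti|iT].
    by rewrite -val_eqE /= inordK.
  by apply/esym/eqP; lia.
rewrite -big_distrl /= -sum_bin_diag (reindex_inj rev_ord_inj) /=.
by congr (_ * _); apply: eq_bigr => k _; rewrite subSS subKn // -ltnS.
Qed.
End Count.

Definition of_columns q n (s : q.-tuple {set 'I_n}) : {set 'I_q * 'I_n} :=
  [set x | x.2 \in tnth s x.1].

Lemma card_of_columns q n (s : q.-tuple {set 'I_n}) :
  #|of_columns s| = \sum_(k < q) #|tnth s k|.
Proof.
rewrite -sum1_card (eq_bigl (fun x : 'I_q * 'I_n => xpredT x.1 && (x.2 \in tnth s x.1))).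
  rewrite -(pair_big_dep xpredT (fun k t => t \in tnth s k) (fun _ _ => 1)) /=.
  by apply: eq_bigr => k _; rewrite sum1_card.
by move=> x; rewrite inE.
Qed.

Lemma card_balanced m n i :
  #|[set G | balanced (m := m) (n := n) G && (#|G| == i)]| =
    'C(m * n + i, i) * 'C(n, i).
Proof.
transitivity #|[set s : (m * n).+1.-tuple {set 'I_n} | marked n i s]|; last first.
  by rewrite card_marked.
rewrite -(card_imset _ (f := @of_columns (m * n).+1 n)); last first.
  move=> s s' E; apply: eq_from_tnth => k; apply/setP => t.
  by have /setP/(_ (k, t)) := E; rewrite !inE.
have bal (s : (m * n).+1.-tuple {set 'I_n}) :
    marked n i s = balanced (m := m) (of_columns s) && (#|of_columns s| == i).
  rewrite card_of_columns; congr ((_ <= _) && _); apply: eq_bigr => k _.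
  by apply: eq_bigl => t; rewrite inE /= valZpK.
apply: eq_card => G; rewrite inE; apply/idP/imsetP => [bG|[s]]; last first.
  by rewrite inE bal => ? ->.
pose s := [tuple [set t : 'I_n | (k, t) \in G] | k < (m * n).+1].
have Gs : G = of_columns s by apply/setP => -[k t]; rewrite inE tnth_mktuple inE.
by exists s; rewrite // inE bal -Gs.
Qed.

(** * Chords between 2h points on a circle *)

(** Membership in the closed anticlockwise arc from i to j. *)
Definition on_arc (i j k : nat) : bool :=
  (if i <= j then i <= k <= j else (i <= k) || (k <= j))%N.

Definition gap (h i j : nat) : nat := (if i <= j then j - i else j + 2 * h - i)%N.

Definition opp (h i : nat) : nat := (if i < h then i + h else i - h)%N.

(** The ends of the chord kl are strictly separated by the chord ij. *)
Definition interleaved (i j k l : nat) : bool :=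
  [&& k != i, k != j, l != i, l != j & on_arc i j k != on_arc i j l].

Section Chords.
Variable h : nat.
Implicit Types i j k l : nat.

Ltac arcs := rewrite /interleaved /on_arc /gap /opp;
  repeat case: ifP; lia.

Lemma opp_lt i : i < 2 * h -> opp h i < 2 * h.
Proof. arcs. Qed.

Lemma oppK i : i < 2 * h -> opp h (opp h i) = i.
Proof. arcs. Qed.

Lemma on_arc_opp i j k : i < 2 * h -> j < 2 * h -> k < 2 * h ->
  on_arc (opp h i) (opp h j) (opp h k) = on_arc i j k.
Proof. arcs. Qed.

Lemma gap_opp i j : i < 2 * h -> j < 2 * h ->
  gap h (opp h i) (opp h j) = gap h i j.
Proof. arcs. Qed.

Lemma gap_opp_r i j : i < 2 * h -> j < 2 * h -> gap h i j <= h ->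
  gap h j (opp h i) = h - gap h i j.
Proof. arcs. Qed.

Lemma gap_flip i j : i < 2 * h -> j < 2 * h -> i != j ->
  gap h j i = 2 * h - gap h i j.
Proof. arcs. Qed.

Lemma gap_half i j : i < 2 * h -> j < 2 * h -> gap h i j = h -> j = opp h i.
Proof. arcs. Qed.

Lemma short_arc_sub i j k : i < 2 * h -> j < 2 * h -> k < 2 * h ->
  0 < gap h i j < h -> on_arc i j k -> on_arc (opp h j) (opp h i) k.
Proof. arcs. Qed.

Lemma short_arc_disj i j k : i < 2 * h -> j < 2 * h -> k < 2 * h ->
  0 < gap h i j < h -> on_arc i j k -> ~~ on_arc (opp h i) (opp h j) k.
Proof. arcs. Qed.

(** A chord of gap less than h and its antipodal image leave two arcs between
them; these carry the vertices of the central polygon. *)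
Lemma central_arcs i j k : i < 2 * h -> j < 2 * h -> k < 2 * h ->
  0 < gap h i j < h ->
  on_arc j i k && on_arc (opp h j) (opp h i) k =
  on_arc j (opp h i) k || on_arc (opp h j) i k.
Proof. arcs. Qed.

Lemma central_disj i j k : i < 2 * h -> j < 2 * h -> k < 2 * h ->
  0 < gap h i j < h -> on_arc j (opp h i) k -> ~~ on_arc (opp h j) i k.
Proof. arcs. Qed.

Lemma short_not_interleaved i j : i < 2 * h -> j < 2 * h ->
  0 < gap h i j <= h -> ~~ interleaved i j (opp h i) (opp h j).
Proof. arcs. Qed.

Lemma interleaved_opp i j k l : i < 2 * h -> j < 2 * h -> k < 2 * h -> l < 2 * h ->
  interleaved (opp h i) (opp h j) (opp h k) (opp h l) = interleaved i j k l.
Proof.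
move=> ih jh kh lh; rewrite /interleaved !on_arc_opp //.
have inj x y : x < 2 * h -> y < 2 * h -> (opp h x == opp h y) = (x == y).
  by move=> xh yh; apply/eqP/eqP => [/(congr1 (opp h))|->//]; rewrite !oppK.
by rewrite !inj.
Qed.

Lemma interleaved_chord a c b d :
  interleaved a (a + c) b (b + d) =
  (a < b < a + c) && (a + c < b + d) || (b < a < b + d) && (b + d < a + c).
Proof.
rewrite /interleaved /on_arc !leq_addr; lia.
Qed.

Lemma interleaved_sym i j k l : i != j -> k != l ->
  interleaved i j k l = interleaved k l i j.
Proof.
by rewrite /interleaved /on_arc; case: (leqP i j); case: (leqP k l); lia.
Qed.

Lemma interleaved_swap i j k l :
  interleaved i j k l = interleaved i j l k.
Proof.
by rewrite /interleaved eq_sym; lia.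
Qed.

(** The distance from a to b on the circle of h points. *)
Definition shift a b := (if a <= b then b - a else b + h - a).

(** Chords of gap at most h are compared with both antipodal images of one of
them; on the quotient circle of h points this is the overlap of two arcs. *)
Lemma interleaved_shift a b c d : a < h -> b < h -> 0 < c <= h -> 0 < d <= h ->
  interleaved a (a + c) b (b + d) || interleaved a (a + c) (opp h b) (opp h (b + d))
  = (0 < shift a b < c) && (c < shift a b + d) ||
    (0 < shift b a < d) && (d < shift b a + c).
Proof.
move=> ah bh /andP[c0 ch] /andP[d0 dh].
rewrite interleaved_chord {1}/opp bh.
rewrite /opp; case: (ltnP (b + d) h) => bdh.
  rewrite addnAC interleaved_chord /shift.
  by case: (leqP a b); case: (leqP b a); lia.
rewrite interleaved_swap.
rewrite [b + h](_ : _ = b + d - h + (2 * h - d)); last lia.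
rewrite interleaved_chord /shift.
by case: (leqP a b); case: (leqP b a); lia.
Qed.
End Chords.

(** * Crossing diagonals of a convex polygon *)

Local Open Scope ring_scope.

Section Orient.
Variable R : realFieldType.
Implicit Types a b c d : 'rV[R]_2.

Lemma orient_rot a b c : orient b c a = orient a b c.
Proof. by rewrite /orient; ring. Qed.

Lemma orient_swap a b c : orient b a c = - orient a b c.
Proof. by rewrite /orient; ring. Qed.

Lemma orient_same a b : orient a b a = 0.
Proof. by rewrite /orient; ring. Qed.

Lemma orient_comb a b c d t :
  orient a b ((1 - t) *: c + t *: d) = (1 - t) * orient a b c + t * orient a b d.
Proof. by rewrite /orient !mxE; ring. Qed.

(** The lines ab and cd meet at the point that divides ab in the ratio of the
signed distances of a and b to cd, and symmetrically; opposite signs put this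
point strictly between the ends. *)
Lemma segments_meet a b c d :
  orient a b c * orient a b d < 0 -> orient c d a * orient c d b < 0 ->
  exists t u : R, [/\ 0 < t < 1, 0 < u < 1 &
    (1 - t) *: a + t *: b = (1 - u) *: c + u *: d].
Proof.
have frac (x y : R) : x * y < 0 -> 0 < x / (x - y) < 1.
  move=> xy; have [x0|x0] : 0 < x \/ x < 0 
    by case: (ltgtP x 0) xy => [||->]; rewrite ?mul0r ?ltxx; auto.
    have y0 : y < 0 by move: xy; rewrite pmulr_rlt0.
    by rewrite divr_gt0 ?ltr_pdivrMr ?mul1r //; lra.
  have y0 : 0 < y by move: xy; rewrite nmulr_rlt0.
  have -> : x / (x - y) = (- x) / (y - x) by rewrite -opprB invrN mulrN mulNr.
  by rewrite divr_gt0 ?ltr_pdivrMr ?mul1r //; lra.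
move=> h k.
exists (orient c d a / (orient c d a - orient c d b)),
  (orient a b c / (orient a b c - orient a b d)); split; [exact: frac|exact: frac|].
have D0 : orient a b c - orient a b d != 0.
  by apply: contraL h => /eqP/subr0_eq->; rewrite -leNgt -expr2 sqr_ge0.
have E : orient c d a - orient c d b = - (orient a b c - orient a b d).
  by rewrite /orient; ring.
rewrite E; apply/rowP => e; rewrite !mxE.
have [->|->] : e = 0 \/ e = 1.
  by case: e => -[|[|//]] ?; [left|right]; apply/val_inj.
all: move: D0; rewrite /orient => D0; field; exact: D0.
Qed.

Lemma comb_same_sign (v x y : R) : 0 < v < 1 ->
  (x <= 0) && (y <= 0) || (0 <= x) && (0 <= y) -> (x != 0) || (y != 0) ->
  (1 - v) * x + v * y != 0.
Proof.
case/andP=> v0; rewrite -subr_gt0 => v1 s nz.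
apply: contraL nz; case/orP: s => /andP[sx sy].
  rewrite naddr_eq0 ?mulr_ge0_le0 ?(ltW v0) ?(ltW v1) // !mulf_eq0 (gt_eqF v0) (gt_eqF v1) /=.
  by case/andP=> -> ->.
rewrite paddr_eq0 ?mulr_ge0 ?(ltW v0) ?(ltW v1) // !mulf_eq0 (gt_eqF v0) (gt_eqF v1) /=.
by case/andP=> -> ->.
Qed.
End Orient.

Lemma set2_eq (T : finType) (a b c d : T) : [set a; b] = [set c; d] ->
  (a = c /\ b = d) \/ (a = d /\ b = c).
Proof.
move=> E.
have := set21 a b; have := set22 a b; rewrite E => /set2P hb /set2P ha.
have := set21 c d; have := set22 c d; rewrite -E => /set2P hd /set2P hc.
by intuition congruence.
Qed.

Section Polygon.
Variables (R : realFieldType) (m n : nat) (P : vertex m n -> 'rV[R]_2).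
Hypothesis conv : convex_polygon P.
Notation V := (vertex m n).
Implicit Types i j k l : V.

Lemma orient_off i j k : i != j -> ~~ on_arc i j k -> 0 < orient (P i) (P j) (P k).
Proof.
rewrite /on_arc; case: (ltngtP i j) => [ij|ji|/val_inj ->]; last by rewrite eqxx.
- move=> _; rewrite negb_and -!ltnNge => /orP[ki|jk]; last exact: conv.
  by rewrite orient_rot; apply: conv.
- move=> _; rewrite negb_or -!ltnNge => /andP[ki jk].
  by rewrite -orient_rot; apply: conv.
Qed.

Lemma orient_end i j k : (k == i) || (k == j) -> orient (P i) (P j) (P k) = 0.
Proof. by case/orP=> /eqP->; rewrite ?orient_same // orient_rot orient_same. Qed.

Lemma on_arc_flip i j k : i != j -> k != i -> k != j -> on_arc j i k = ~~ on_arc i j k.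
Proof. rewrite -!val_eqE /on_arc /=; case: (leqP i j); case: (leqP j i); lia. Qed.

Lemma on_arc_end i j k : (k == i) || (k == j) -> on_arc i j k.
Proof. rewrite -!val_eqE /on_arc /=; case: (leqP i j); lia. Qed.

Lemma orient_inside i j k :
  i != j -> k != i -> k != j -> on_arc i j k -> orient (P i) (P j) (P k) < 0.
Proof.
move=> ij ki kj; rewrite -[on_arc _ _ _]negbK -on_arc_flip // => /orient_off.
by rewrite orient_swap oppr_gt0 eq_sym => /(_ ij).
Qed.

Lemma orient_le0 i j k : i != j -> (orient (P i) (P j) (P k) <= 0) = on_arc i j k.
Proof.
move=> ij; have [e|] := boolP ((k == i) || (k == j)).
  by rewrite orient_end // on_arc_end ?lexx.
rewrite negb_or => /andP[ki kj].
have [a|a] := boolP (on_arc i j k); first by rewrite ltW ?orient_inside.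
by apply/negbTE; rewrite -ltNge orient_off.
Qed.

Lemma orient_ge0 i j k : i != j -> (0 <= orient (P i) (P j) (P k)) = on_arc j i k.
Proof. by move=> ij; rewrite -orient_le0 1?eq_sym // [in RHS]orient_swap oppr_le0. Qed.

Lemma orient_prod_lt0 i j k l : i != j -> interleaved i j k l ->
  orient (P i) (P j) (P k) * orient (P i) (P j) (P l) < 0.
Proof.
move=> ij /and5P[ki kj li lj].
have [ak|ak] := boolP (on_arc i j k); have [al|al] := boolP (on_arc i j l) => // _.
  by rewrite nmulr_rlt0 ?orient_off ?orient_inside.
by rewrite pmulr_rlt0 ?orient_off ?orient_inside.
Qed.

(** If the ends of kl are not strictly separated by ij, and are not those of ij,
then the interior of kl stays strictly on one side of the line ij. *)
Lemma crossingP i j k l : i != j -> k != l ->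
  crossing P [set i; j] [set k; l] <-> interleaved i j k l.
Proof.
move=> ij kl; split=> [[ne [x [[i' [j' [E1 [t [t01 xt]]]]] [k' [l' [E2 [u [u01 xu]]]]]]]]|I].
  have x0 : orient (P i) (P j) x = 0.
    rewrite xt orient_comb.
    by case: (set2_eq E1) => -[<- <-]; rewrite !orient_end ?eqxx ?orbT // !mulr0 addr0.
  have {k' l' E2 xu u01} [v [v01 xv]] : exists v : R, 0 < v < 1 /\
     x = (1 - v) *: P k + v *: P l.
    case: (set2_eq E2) => -[-> ->]; first by exists u.
    exists (1 - u); split; first by lra.
    by rewrite addrC subKr.
  move: x0; rewrite xv orient_comb => x0.
  have nz p : p != i -> p != j -> orient (P i) (P j) (P p) != 0.
    move=> pi pj; have [a|a] := boolP (on_arc i j p).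
      by rewrite lt_eqF // orient_inside.
    by rewrite gt_eqF // orient_off.
  apply/negPn/negP => nI.
  have [both|nboth] := boolP (((k == i) || (k == j)) && ((l == i) || (l == j))).
    apply: ne; case/andP: both => /orP[]/eqP hk /orP[]/eqP hl; subst k l;
      rewrite ?eqxx // in kl *; by rewrite setUC.
  have same : (on_arc i j k && on_arc i j l) || (on_arc j i k && on_arc j i l).
    move: nI nboth ij; rewrite /interleaved /on_arc -!val_eqE /=.
    case: (leqP i j); case: (leqP j i); lia.
  have nz2 : (orient (P i) (P j) (P k) != 0) || (orient (P i) (P j) (P l) != 0).
    move: nboth; rewrite negb_and !negb_or => /orP[/andP[]|/andP[]] h1 h2.
      by rewrite nz.
    by rewrite (nz l) ?orbT.
  move/eqP: x0; apply/negP; apply: comb_same_sign nz2 => //.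
  by rewrite !orient_le0 // !orient_ge0.
have [|t [u [t01 u01 E]]] := segments_meet (orient_prod_lt0 ij I)
  (orient_prod_lt0 (i := k) (j := l) kl _).
  by rewrite -interleaved_sym.
split.
  by case/and5P: I => ki kj _ _ _ /set2_eq[[?]|[_ ?]]; subst; rewrite eqxx in ki kj.
exists ((1 - t) *: P i + t *: P j); split; first by exists i, j; split=> //; exists t.
by exists k, l; split=> //; exists u.
Qed.

End Polygon.

Local Close Scope ring_scope.

(** * Pieces of a dissection *)

Lemma maxset_antichain (T : finType) (A : {set {set T}}) (S : {set T}) :
  {in A &, forall X Y : {set T}, X \subset Y -> X = Y} ->
  maxset (fun X : {set T} => [exists Y in A, X \subset Y]) S = (S \in A).
Proof.
move=> anti; apply/maxsetP/idP => [[/exists_inP[Y YA SY] max]|SA].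
  by rewrite -(max Y) //; apply/exists_inP; exists Y.
split; first by apply/exists_inP; exists S.
move=> X /exists_inP[Y YA XY] SX; apply/eqP; rewrite eqEsubset SX andbT.
by rewrite (anti S Y SA YA (subset_trans SX XY)).
Qed.

Section Vertices.
Variables m n : nat.
Notation V := (vertex m n).
Notation h := (m * n).+1.
Implicit Types (i j k : V).

Lemma vertex_lt i : i < 2 * h.
Proof. by have := ltn_ord i; rewrite mulnS mulnA. Qed.

Lemma vertex_eqE i j : (i == j) = (i == j :> nat).
Proof. by []. Qed.

Lemma antipodeE i : antipode i = opp h i :> nat.
Proof.
have hN : h %% (2 * m * n).+2 = h by rewrite modn_small //; lia.
rewrite /antipode /= hN.
move: (nat_of_ord i) (vertex_lt i) => p; rewrite (_ : (2 * m * n).+2 = 2 * h); last by lia.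
rewrite /opp => ph; case: ltnP => hp; first by rewrite modn_small //; lia.
by rewrite (_ : p + h = p - h + 2 * h) ?modnDr ?modn_small //; lia.
Qed.

Lemma antipodeK : involutive (@antipode m n).
Proof. by move=> i; apply/ord_inj; rewrite !antipodeE oppK ?vertex_lt. Qed.

Lemma antipode_inj : injective (@antipode m n).
Proof. exact: inv_inj antipodeK. Qed.

Lemma antipode_neq i : antipode i != i.
Proof. by rewrite vertex_eqE antipodeE /opp; case: ifP; lia. Qed.

Definition segment i j : {set V} := [set k : V | on_arc i j k].

Lemma antipode_segment i j :
  antipode @: segment i j = segment (antipode i) (antipode j).
Proof.
apply/setP => k; rewrite -[k]antipodeK mem_imset ?inE; last exact: antipode_inj.
by rewrite !antipodeE on_arc_opp ?opp_lt ?vertex_lt.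
Qed.

Lemma card_segment i j : #|segment i j| = (gap h i j).+1.
Proof.
have iN := ltn_ord i; have jN := ltn_ord j.
have below b c : b <= c -> c <= (2 * m * n).+2 ->
    #|[set k : V | b <= k < c]| = c - b.
  move=> bc cN; rewrite -[c in RHS](card_below cN).
  rewrite -[b in RHS](card_below (leq_trans bc cN)).
  rewrite -cardsDS; last by apply/subsetP => k; rewrite !inE => /leq_trans; apply.
  by apply: eq_card => k; rewrite !inE -leqNgt.
rewrite /gap; case: leqP => ij.
  rewrite -subSn // -below //; last exact: ltnW.
  by apply: eq_card => k; rewrite !inE /on_arc ij ltnS.
have := cardsC [set k : V | j.+1 <= k < i].
rewrite below // 1?ltnW // card_ord => /(canRL (addKn _)) E.
suff -> : segment i j = ~: [set k : V | j.+1 <= k < i].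
  by rewrite E; lia.
by apply/setP => k; rewrite !inE /on_arc leqNgt ij /=; lia.
Qed.

Lemma ends_in_segment i j : (i \in segment i j) * (j \in segment i j).
Proof. by rewrite !inE /on_arc !leqnn !orbT !andbT; case: ifP. Qed.

(** When j is the antipode of i the two diagonals coincide, so this is also the
shape of the diameters ([chord_pair_diameter]). *)
Definition chord_pair i j : {set {set V}} :=
  [set [set i; j]; [set antipode i; antipode j]].

Lemma chord_pair_swap i j : chord_pair i j = chord_pair j i.
Proof. by rewrite /chord_pair ![[set _; j]]setUC ![[set _; antipode j]]setUC. Qed.

Lemma chord_pair_antipode i j :
  chord_pair (antipode i) (antipode j) = chord_pair i j.
Proof. by rewrite /chord_pair !antipodeK setUC. Qed.

Lemma chord_pair_diameter i : chord_pair i (antipode i) = [set [set i; antipode i]].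
Proof. by rewrite /chord_pair antipodeK [[set antipode i; i]]setUC setUid. Qed.

Lemma neq_gap i j : (0 < gap h i j) = (i != j).
Proof.
rewrite vertex_eqE; have := vertex_lt i; have := vertex_lt j.
by rewrite /gap; case: ifP; lia.
Qed.

Lemma segment_cap i j : i != j -> segment i j :&: segment j i = [set i; j].
Proof.
move=> ij; apply/setP => k; rewrite !inE !vertex_eqE /on_arc.
by move: ij; rewrite vertex_eqE; case: (leqP i j); case: (leqP j i); lia.
Qed.

Lemma eq_succ i j : (j == (i + 1)%R) = (gap h i j == 1).
Proof.
have E1 : 1 %% (2 * m * n).+2 = 1 by rewrite modn_small.
rewrite vertex_eqE /= E1.
move: (nat_of_ord i) (nat_of_ord j) (vertex_lt i) (vertex_lt j) => p q.
rewrite (_ : (2 * m * n).+2 = 2 * h); last by lia.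
move=> ph qh; rewrite /gap; case: (ltnP p.+1 (2 * h)) => ph'.
  by rewrite modn_small ?addn1 //; case: (leqP p q) => pq; lia.
rewrite (_ : p + 1 = 2 * h) ?modnn; last by lia.
by case: (leqP p q) => pq; lia.
Qed.

Definition central i j : {set V} :=
  segment j (antipode i) :|: segment (antipode j) i.

Section Short.
Variables i j : V.
Hypothesis short : 1 < gap h i j < h.
Let short0 : 0 < gap h i j < h.
Proof. by case/andP: short => /ltnW-> ->. Qed.

Definition three_pieces : {set {set V}} :=
  [set segment i j; segment (antipode i) (antipode j); central i j].

(** This is the form in which the central polygon occurs as a piece: the vertices
on the far side of both diagonals. *)
Lemma centralI : central i j = segment j i :&: segment (antipode j) (antipode i).
Proof.
by apply/setP => k; rewrite !inE !antipodeE central_arcs ?vertex_lt.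
Qed.

Lemma segment_sub_opposite : segment i j \subset segment (antipode j) (antipode i).
Proof.
by apply/subsetP => k; rewrite !inE !antipodeE; apply: short_arc_sub; rewrite ?vertex_lt.
Qed.

Lemma segments_disj : segment i j :&: segment (antipode i) (antipode j) = set0.
Proof.
apply/setP => k; rewrite !inE !antipodeE; apply/andP => -[a].
by apply/negP; apply: short_arc_disj; rewrite ?vertex_lt.
Qed.

Lemma card_central : #|central i j| = 2 * (h - gap h i j) + 2.
Proof.
have g1 : gap h j (antipode i) = h - gap h i j.
  by rewrite antipodeE gap_opp_r ?vertex_lt // ltnW //; case/andP: short.
have g2 : gap h (antipode j) i = h - gap h i j.
  by rewrite -g1 -[in LHS](antipodeK i) !antipodeE gap_opp ?vertex_lt // opp_lt ?vertex_lt.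
rewrite cardsU !card_segment g1 g2 (_ : _ :&: _ = set0) ?cards0; first lia.
apply/setP => k; rewrite !inE !antipodeE; apply/andP => -[a].
by apply/negP; apply: central_disj; rewrite ?vertex_lt.
Qed.

Lemma antipode_central : antipode @: central i j = central i j.
Proof. by rewrite /central imsetU !antipode_segment !antipodeK setUC. Qed.

Lemma central_has : (i \in central i j) * (antipode i \in central i j).
Proof. by rewrite !in_setU !ends_in_segment !orbT. Qed.

Lemma segment_not_central : ~~ (segment i j \subset central i j).
Proof.
apply: contraTN short => sub.
have : segment i j \subset segment i j :&: segment j i.
  by rewrite subsetI subxx (subset_trans sub) // centralI subsetIl.
rewrite segment_cap; last by rewrite -neq_gap; case/andP: short0.
move/subset_leq_card; rewrite card_segment cards2.
by case: (i != j) => /= le; rewrite negb_and -leqNgt; apply/orP; left; lia.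
Qed.

(** The first two pieces are disjoint and the third one contains only the ends of
their diagonals; i and its antipode distinguish the pieces, save that the outer
ones need an inner vertex to leave the central one, hence the gap above 1. *)
Lemma three_pieces_antichain :
  {in three_pieces &, forall X Y : {set V}, X \subset Y -> X = Y}.
Proof.
have no (X Y : {set V}) k : k \in X -> k \notin Y -> ~~ (X \subset Y).
  by move=> kX; apply: contra => /subsetP->.
have iB : i \notin segment (antipode i) (antipode j).
  apply/negP => iB; have := in_set0 i; rewrite -segments_disj in_setI iB.
  by rewrite ends_in_segment.
have iA : antipode i \notin segment i j.
  apply/negP => iA; have := in_set0 (antipode i); rewrite -segments_disj in_setI iA.
  by rewrite ends_in_segment.
have nAC := segment_not_central.
have nBC : ~~ (segment (antipode i) (antipode j) \subset central i j).
  apply: contra nAC => /(imsetS antipode).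
  by rewrite antipode_central antipode_segment !antipodeK.
have [iC aC] := central_has.
have [iS _] := ends_in_segment i j.
have [aS _] := ends_in_segment (antipode i) (antipode j).
move=> X Y; rewrite !inE -!orbA => /or3P[]/eqP-> /or3P[]/eqP-> //;
  apply: contraTeq => _ //; by [exact: (no _ _ i)|exact: (no _ _ (antipode i))].
Qed.

Lemma segment_neq_antipode : antipode @: segment i j != segment i j.
Proof.
rewrite antipode_segment; apply/eqP => E; have := segments_disj.
by rewrite E setIid => /setP/(_ i); rewrite in_set0 ends_in_segment.
Qed.
End Short.
End Vertices.

Section Dissection.
Variables (R : realFieldType) (m n : nat) (P : vertex m n -> 'rV[R]_2).
Hypothesis conv : convex_polygon P.
Notation V := (vertex m n).
Notation h := (m * n).+1.
Implicit Types (i j k : V).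

Lemma one_sidedE i j (S : {set V}) : i != j ->
  one_sided P [set i; j] S = (S \subset segment i j) || (S \subset segment j i).
Proof.
have side (a b : V) : a != b ->
    ([forall k in S, (0 <= orient (P a) (P b) (P k))%R]
     || [forall k in S, (orient (P a) (P b) (P k) <= 0)%R]) =
    (S \subset segment a b) || (S \subset segment b a).
  move=> ab; rewrite orbC; congr (_ || _).
    apply/forall_inP/subsetP => H k /H; by rewrite inE orient_le0.
  by apply/forall_inP/subsetP => H k /H; rewrite inE orient_ge0.
move=> ij; apply/idP/idP => [/forallP/(_ i)/forallP/(_ j)|H].
  by rewrite eqxx side.
apply/forallP => a; apply/forallP => b; apply/implyP => /eqP/set2_eq.
by case=> -[<- <-]; rewrite side // 1?eq_sym // orbC.
Qed.

Lemma pieces_antichain (b A : {set {set V}}) :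
  (forall S, [forall d in b, one_sided P d S] = [exists Y in A, S \subset Y]) ->
  {in A &, forall X Y : {set V}, X \subset Y -> X = Y} ->
  pieces P b = A.
Proof.
move=> E anti; apply/setP => S; rewrite inE -(maxset_antichain S anti).
by congr (maxset _ S); apply/funext => X; exact: E.
Qed.

(** Each of the two segments lies on the far side of the other diagonal, so of
the four intersections of sides one is empty and the others are the pieces. *)
Lemma pieces_short i j : 1 < gap h i j < h ->
  pieces P (chord_pair i j) = three_pieces i j.
Proof.
move=> short; have short0 : 0 < gap h i j < h by case/andP: short => /ltnW-> ->.
have ij : i != j by rewrite -neq_gap; case/andP: short0.
apply: pieces_antichain; last exact: three_pieces_antichain.
move=> S.
have -> : [forall d in chord_pair i j, one_sided P d S] =
    one_sided P [set i; j] S && one_sided P [set antipode i; antipode j] S.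
  apply/forall_inP/andP => [H|[H1 H2] d /set2P[]->//].
  by rewrite !H ?set21 ?set22.
have -> : [exists Y in three_pieces i j, S \subset Y] =
    [|| S \subset segment i j, S \subset segment (antipode i) (antipode j) |
        S \subset central i j].
  apply/exists_inP/or3P => [[Y]|[] H].
  - by rewrite !inE -orbA => /or3P[]/eqP-> H; [apply: Or31|apply: Or32|apply: Or33].
  - by exists (segment i j); rewrite ?inE ?eqxx.
  - by exists (segment (antipode i) (antipode j)); rewrite ?inE ?eqxx ?orbT.
  - by exists (central i j); rewrite ?inE ?eqxx ?orbT.
rewrite !one_sidedE ?(inj_eq (@antipode_inj m n)) // centralI // subsetI.
have AB : S \subset segment i j -> S \subset segment (antipode j) (antipode i).
  by move=> H; apply: subset_trans H _; apply: segment_sub_opposite.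
have BA : S \subset segment (antipode i) (antipode j) -> S \subset segment j i.
  move=> H; apply: subset_trans H _.
  have := @segment_sub_opposite _ _ (antipode i) (antipode j).
  by rewrite !antipodeE gap_opp ?vertex_lt // !antipodeK; apply.
by apply/idP/idP; move: AB BA; do 4 case: (_ \subset _) => //=; intuition.
Qed.

Lemma pieces_diameter i :
  pieces P [set [set i; antipode i]] =
  [set segment i (antipode i); segment (antipode i) i].
Proof.
have ai : i != antipode i by rewrite eq_sym antipode_neq.
have card2 : #|segment i (antipode i)| = #|segment (antipode i) i|.
  rewrite -[RHS](card_imset _ (@antipode_inj m n)) antipode_segment antipodeK.
  by [].
apply: pieces_antichain => [S|X Y].
  apply/forall_inP/exists_inP => [/(_ _ (set11 _))|[Y YA SY] d].
    rewrite one_sidedE // => /orP[] H.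
      by exists (segment i (antipode i)); rewrite ?set21.
    by exists (segment (antipode i) i); rewrite ?set22.
  rewrite inE => /eqP->; rewrite one_sidedE //.
  by case/set2P: YA SY => -> ->; rewrite ?orbT.
have eqc (A B : {set V}) : #|A| = #|B| -> A \subset B -> A = B.
  by move=> c s; apply/eqP; rewrite eqEcard s c leqnn.
by case/set2P=> -> /set2P[]-> //; apply: eqc.
Qed.

Lemma short_noncrossing i j : 0 < gap h i j <= h ->
  ~ crossing P [set i; j] [set antipode i; antipode j].
Proof.
move=> short; have ij : i != j by rewrite -neq_gap; case/andP: short.
rewrite crossingP // ?(inj_eq (@antipode_inj m n)) // !antipodeE.
by apply/negP; apply: short_not_interleaved; rewrite ?vertex_lt.
Qed.

(** The segment cut off by ij is a piece and is moved by the antipode, so it is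
one of the two (ms+2)-gons and its size gives the gap. *)
Lemma short_dissects i j s : 1 < gap h i j < h -> s <= n ->
  dissects P (chord_pair i j) s -> gap h i j = (m * s).+1.
Proof.
move=> short sn [Q [Q' [C [un [cQ cQ'] cC aC]]]].
have short0 : 0 < gap h i j < h by case/andP: short => /ltnW-> ->.
case: ltnP => [_|ns [E _]]; last first.
  have := set21 [set i; j] [set antipode i; antipode j].
  have := set22 [set i; j] [set antipode i; antipode j].
  rewrite -/(chord_pair i j) E !inE => /eqP<- /eqP/set2_eq[[/esym/eqP]|[]].
    by rewrite (negPf (antipode_neq i)).
  move=> /(congr1 (@nat_of_ord _)) ia; case/andP: short => _.
  move: ia; rewrite antipodeE.
  have := vertex_lt j; rewrite /gap /opp => jh ->.
  by do 2 case: ifP; lia.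
rewrite pieces_short // => /setP/(_ (segment i j)); rewrite !inE eqxx /= => /esym.
rewrite -orbA => /or3P[]/eqP E.
- by move: cQ; rewrite -E card_segment; lia.
- by move: cQ'; rewrite -E card_segment; lia.
- by move: aC (segment_neq_antipode short); rewrite -E => ->; rewrite eqxx.
Qed.

Lemma short_is_vertex i j s : 0 < s < n -> gap h i j = (m * s).+1 -> 0 < m ->
  is_vertex P (chord_pair i j).
Proof.
move=> /andP[s0 sn] g m0.
have ms : 0 < m * s by rewrite muln_gt0 m0.
have msn : m * s < m * n by rewrite ltn_pmul2l.
have short : 1 < gap h i j < h by rewrite g; lia.
have short0 : 0 < gap h i j < h by case/andP: short => /ltnW-> ->.
have ij : i != j by rewrite -neq_gap; case/andP: short0.
split.
  right; exists i, j; split=> //; first exact/eqP.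
    rewrite /consecutive !eq_succ (@gap_flip h i j) ?vertex_lt //.
    by rewrite g; apply/negP; lia.
  by apply: short_noncrossing; case/andP: short0 => -> /ltnW.
exists s; split; first by rewrite s0 ltnW.
exists (segment i j), (segment (antipode i) (antipode j)), (central i j).
rewrite sn pieces_short //; split=> //.
- rewrite /= !inE negb_or -antipode_segment eq_sym segment_neq_antipode // !andbT.
  apply/andP; split.
    by apply: contra (segment_not_central short) => /eqP->.
  apply: contra (segment_not_central short) => /eqP E; rewrite -(antipode_central i j) -E.
  by rewrite !antipode_segment !antipodeK.
- by rewrite -antipode_segment card_imset ?card_segment ?g; [lia|exact: antipode_inj].
- by rewrite card_central // g; rewrite subSS -mulnBr mulnA.
- exact: antipode_central.
Qed.

Lemma diameter_is_vertex i : 0 < m -> 0 < n -> is_vertex P [set [set i; antipode i]].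
Proof.
move=> m0 n0; split; first by left; exists i.
exists n; split; first by rewrite n0 leqnn.
have ai := antipode_neq i.
have gi : gap h i (antipode i) = h.
  by rewrite antipodeE; have := vertex_lt i; rewrite /gap /opp; do 2 case: ifP; lia.
have gi' : gap h (antipode i) i = h.
  by rewrite gap_flip ?vertex_lt 1?eq_sym // gi; lia.
exists (segment i (antipode i)), (segment (antipode i) i), [set i; antipode i].
rewrite ltnn pieces_diameter !card_segment gi gi' cards2 eq_sym ai subnn.
have two (A B : {set V}) : #|A| != #|B| -> A != B by apply: contraNneq => ->.
have mn0 : 0 < m * n by rewrite muln_gt0 m0.
split=> //; try by rewrite ?muln0; lia.
  rewrite /= !inE negb_or !(two _ [set i; antipode i]);
    rewrite ?card_segment ?cards2 ?gi ?gi' ?[i == _]eq_sym ?ai; try by lia.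
  rewrite !andbT; apply/eqP => E; have := segment_cap ai.
  rewrite E setIid => /(congr1 (fun A : {set V} => #|A|)).
  by rewrite card_segment gi' cards2 ai; lia.
by rewrite imsetU !imset_set1 antipodeK setUC.
Qed.

(** * Faces as noncrossing sets of arcs *)

Definition src (x : 'I_h * 'I_n) : V := inord x.1.
Definition tgt (x : 'I_h * 'I_n) : V := inord (x.1 + (m * x.2.+1).+1).
Definition bdiag x := chord_pair (src x) (tgt x).

Lemma size_lt (s : 'I_n) : m * s.+1 < h.
Proof. by rewrite ltnS leq_mul2l ltn_ord orbT. Qed.

Lemma srcE x : src x = x.1 :> nat.
Proof. by rewrite inordK //; have := ltn_ord x.1; lia. Qed.

Lemma tgtE x : tgt x = x.1 + (m * x.2.+1).+1 :> nat.
Proof. by rewrite inordK //; have := ltn_ord x.1; have := size_lt x.2; lia. Qed.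

Lemma gap_bdiag x : gap h (src x) (tgt x) = (m * x.2.+1).+1.
Proof. by rewrite srcE tgtE /gap leq_addr addKn. Qed.

(** The arc starts at whichever of i and its antipode comes among the first h
vertices. *)
Lemma bdiag_ex i j (s : 'I_n) : gap h i j = (m * s.+1).+1 ->
  exists x, chord_pair i j = bdiag x.
Proof.
have half (a b : V) : a < h -> gap h a b = (m * s.+1).+1 ->
    exists x, chord_pair a b = bdiag x.
  move=> ah g; exists (Ordinal ah, s); rewrite /bdiag.
  have -> : src (Ordinal ah, s) = a by apply/ord_inj; rewrite srcE.
  suff -> : tgt (Ordinal ah, s) = b by [].
  apply/ord_inj; rewrite tgtE /= -g; move: g; have := size_lt s.
  have := vertex_lt b; rewrite /gap; case: ifP; lia.
case: (ltnP i h) => ih; first exact: half.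
move=> g; rewrite -chord_pair_antipode; apply: half.
  by rewrite antipodeE; have := vertex_lt i; rewrite /opp; case: ifP; lia.
by rewrite !antipodeE gap_opp ?vertex_lt.
Qed.

(** A pair of diagonals can be oriented so that its gap is at most h, and the
dissection condition then forces the gap to be that of an arc; diameters are
the arcs of gap h. *)
Lemma is_vertexP b : 0 < m -> 0 < n ->
  is_vertex P b <-> exists x, b = bdiag x.
Proof.
move=> m0 n0; have n1 : n.-1 < n by rewrite prednK.
have diam (a : V) : gap h a (antipode a) = (m * (Ordinal n1).+1).+1.
  rewrite antipodeE (prednK n0 : (Ordinal n1).+1 = n); have := vertex_lt a.
  by rewrite /gap /opp; do 2 case: ifP; lia.
split=> [[bd [s [/andP[s0 sn] ds]]]|[x ->]].
  case: bd => [[i E]|[i [j [/eqP ij nc _ E]]]].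
    by rewrite E -chord_pair_diameter; apply: bdiag_ex (diam i).
  rewrite -/(chord_pair i j) in E.
  have short (a c : V) : b = chord_pair a c -> 1 < gap h a c < h -> exists x, b = bdiag x.
    move=> Eb g; rewrite Eb in ds; have gs := short_dissects g sn ds.
    have s1 : s.-1 < n by rewrite prednK.
    by rewrite Eb; apply: (@bdiag_ex _ _ (Ordinal s1)); rewrite gs /= prednK.
  have gf : gap h j i = 2 * h - gap h i j by rewrite gap_flip ?vertex_lt.
  move: nc; rewrite /consecutive !eq_succ gf => nc.
  have g0 : 0 < gap h i j by rewrite neq_gap.
  have g0' : 0 < gap h j i by rewrite neq_gap eq_sym.
  case: (ltngtP (gap h i j) h) => [lt|gt|e].
  - by apply: short E _; rewrite lt andbT; lia.
  - by apply: (short j i); [rewrite chord_pair_swap|rewrite gf; lia].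
  - have -> : b = chord_pair i (antipode i).
      rewrite E; congr (chord_pair _ _); apply/ord_inj; rewrite antipodeE.
      by apply: gap_half; rewrite ?vertex_lt.
    exact: bdiag_ex (diam i).
have := ltn_ord x.2; rewrite leq_eqVlt => /orP[/eqP xn|xn].
  have -> : bdiag x = [set [set src x; antipode (src x)]].
    rewrite -chord_pair_diameter; congr (chord_pair _ _); apply/ord_inj.
    by rewrite antipodeE; apply: gap_half; rewrite ?vertex_lt // gap_bdiag xn.
  exact: diameter_is_vertex.
by apply: (@short_is_vertex _ _ x.2.+1); rewrite ?gap_bdiag.
Qed.

Lemma bdiag_inj : 0 < m -> injective bdiag.
Proof.
move=> m0 x y; rewrite /bdiag => E.
have xl := ltn_ord x.1; have yl := ltn_ord y.1.
have xs := size_lt x.2; have ys := size_lt y.2.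
have [e1 e2] : x.1 = y.1 :> nat /\ m * x.2.+1 = m * y.2.+1.
  have := set21 [set src x; tgt x] [set antipode (src x); antipode (tgt x)].
  rewrite -/(chord_pair _ _) E.
  case/set2P => /set2_eq[] [/(congr1 (@nat_of_ord _)) + /(congr1 (@nat_of_ord _))];
    rewrite ?antipodeE !srcE !tgtE /opp; do ? case: ifP; lia.
rewrite [x]surjective_pairing [y]surjective_pairing; congr (_, _); apply/ord_inj => //.
by apply/eqP; rewrite -eqSS -(eqn_pmul2l m0) e2.
Qed.

Lemma chord_ends x : src x != tgt x.
Proof. by rewrite -neq_gap gap_bdiag. Qed.

Lemma overlapsE (x y : 'I_h * 'I_n) : overlaps (m := m) x y =
  (0 < shift h x.1 y.1 < (m * x.2.+1).+1) &&
  ((m * x.2.+1).+1 < shift h x.1 y.1 + (m * y.2.+1).+1).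
Proof.
have xl := ltn_ord x.1; have yl := ltn_ord y.1.
have -> : shift h x.1 y.1 = (y.1 + (h - x.1)) %% h.
  rewrite /shift; case: leqP => xy; last by rewrite modn_small; lia.
  by rewrite (_ : y.1 + _ = y.1 - x.1 + h) ?modnDr ?modn_small; lia.
by rewrite /overlaps /= ltnS addnS ltnS andbA.
Qed.

(** Of the four pairs of diagonals to test, the antipode identifies two with the
other two. *)
Lemma Bcrossing_bdiag x y :
  Bcrossing P (bdiag x) (bdiag y) <-> overlaps (m := m) x y || overlaps (m := m) y x.
Proof.
have xl := ltn_ord x.1; have yl := ltn_ord y.1.
have xs := size_lt x.2; have ys := size_lt y.2.
have cx := chord_ends x; have cy := chord_ends y.
have acx : antipode (src x) != antipode (tgt x) by rewrite (inj_eq (@antipode_inj m n)).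
have acy : antipode (src y) != antipode (tgt y) by rewrite (inj_eq (@antipode_inj m n)).
rewrite !overlapsE -interleaved_shift // -!tgtE -!srcE -!antipodeE.
have I1 : interleaved (antipode (src x)) (antipode (tgt x))
    (antipode (src y)) (antipode (tgt y)) =
    interleaved (src x) (tgt x) (src y) (tgt y).
  by rewrite !antipodeE interleaved_opp ?vertex_lt.
have I2 : interleaved (antipode (src x)) (antipode (tgt x)) (src y) (tgt y) =
    interleaved (src x) (tgt x) (antipode (src y)) (antipode (tgt y)).
  rewrite -[in LHS](antipodeK (src y)) -[in LHS](antipodeK (tgt y)).
  rewrite (antipodeE (src x)) (antipodeE (tgt x)).
  rewrite (antipodeE (antipode (src y))) (antipodeE (antipode (tgt y))).
  by rewrite interleaved_opp ?vertex_lt.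
split=> [[d [e [/set2P[]-> /set2P[]-> /(crossingP conv)]]]|].
- by move=> /(_ cx cy) ->.
- by move=> /(_ cx acy) ->; rewrite orbT.
- by move=> /(_ acx cy); rewrite I2 => ->; rewrite orbT.
- by move=> /(_ acx acy); rewrite I1 => ->.
case/orP=> I; exists [set src x; tgt x].
  exists [set src y; tgt y]; split; rewrite ?set21 //.
  exact/crossingP.
exists [set antipode (src y); antipode (tgt y)]; split; rewrite ?set21 ?set22 //.
exact/crossingP.
Qed.

Lemma is_face_bdiag F : 0 < m -> 0 < n ->
  is_face P F <-> exists2 S, noncrossing (m := m) S & F = bdiag @: S.
Proof.
move=> m0 n0; have inj := bdiag_inj m0; split=> [[Fv Fx]|[S nc ->]].
  have E : F = bdiag @: (bdiag @^-1: F).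
    apply/setP => b; apply/idP/imsetP => [bF|[x + ->]]; last by rewrite inE.
    have [x bx] := (is_vertexP b m0 n0).1 (Fv b bF).
    by exists x; rewrite // inE -bx.
  exists (bdiag @^-1: F) => //; apply/forall_inP => x xF; apply/forall_inP => y yF.
  apply/negP => o; rewrite !inE in xF yF; apply: (Fx _ _ xF yF).
    move=> /inj xy; move: o; rewrite overlapsE xy /shift leqnn subnn; done.
  by apply/Bcrossing_bdiag; rewrite o.
split=> [_ /imsetP[x _ ->]|_ _ /imsetP[x xS ->] /imsetP[y yS ->] _].
  by apply/is_vertexP => //; exists x.
move/Bcrossing_bdiag; have /forall_inP H := nc.
have /forall_inP/(_ _ yS)/negPf-> := H x xS.
by have /forall_inP/(_ _ xS)/negPf-> := H y yS.
Qed.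
End Dissection.

Local Open Scope ring_scope.

Theorem theorem1p2 (R : realFieldType) (m n : nat) (hm : (1 <= m)%N)
    (hn : (1 <= n)%N) (P : vertex m n -> 'rV[R]_2)
    (hconvex : convex_polygon P) (hsym : centrally_symmetric P)
    (i : nat) (hi : (i <= n)%N) :
  #|[set F in DeltaB P | face_dim F == i%:Z - 1]| =
    ('C(m * n + i, i) * 'C(n, i))%N.
Proof.
rewrite -card_balanced -card_noncrossing //.
have inj := bdiag_inj (n := n) hm.
rewrite -[RHS](card_imset _ (imset_inj inj)); apply: eq_card => F.
rewrite !inE; apply/andP/imsetP => [[/asboolP/is_face_bdiag[]// S nc ->]|[S]].
  rewrite /face_dim (inj_eq (addIr _)) eqz_nat card_imset // => Si.
  by exists S; rewrite // inE nc.
rewrite inE => /andP[nc /eqP Si] ->; split.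
  by apply/asboolP/is_face_bdiag => //; exists S.
by rewrite /face_dim card_imset // Si.
Qed.
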